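(* Let $R$ be a simply connected region in the square lattice such that the point $(0,0)$ lies on $\partial R$, and let $H$ be the set of height functions $h$ of domino tilings of $R$ satisfying $h(0,0)=0$ (assume $H\neq\emptyset$). Let $U$ be a set of lattice points of $R$ with $U \supseteq \partial R$, and let $h' : U \to \mathbb{Z}$ satisfy $h' = h$ on all points of $\partial R$ and $h' \equiv h \pmod 4$ on all points of $U$, where $h$ is any height function in $H$. Then there exists $h_{\mathrm{ext}} \in H$ with $h_{\mathrm{ext}} = h'$ on all points of $U$ if and only if $$h'(y) - h'(x) \le \alpha(x,y)$$ for all pairs of points $x,y \in U$ such that $x \sim_R y$.
   Context: A region $R$ is a finite simply connected union of closed unit squares with corners in $\mathbb{Z}^2$; its points are the lattice points in $R$, and $\partial R$ is its boundary. The unit square with lower-left corner $(a,b)$ is white if $a+b$ is even, black otherwise. A unit grid edge belongs to a domino tiling $T$ of $R$ if it lies on the boundary of a domino of $T$. The height function $h_T$ of $T$ is an integer function on lattice points of $R$ such that for every edge $(x,y)$ belonging to $T$ having, when traversed from $x$ to $y$, a white square to its left, $h_T(x)-h_T(y)=1$ (unique up to an additive constant). All height functions in $H$ agree on $\partial R$ and are congruent modulo $4$ at every point. For $x=(a,b)$ and $y = x+(i,j)$, let $\delta(i,j)$ denote $i-j \bmod 2 \in\{0,1\}$ and define $\alpha(x,y) = 2\|y-x\|_\infty + \delta(i,j)$ if $\delta(a,b)=0$ and $i\ge j$; $\alpha(x,y)=2\|y-x\|_\infty - \delta(i,j)$ if $\delta(a,b)=0$ and $i<j$; $\alpha(x,y)=2\|y-x\|_\infty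 - \delta(i,j)$ if $\delta(a,b)=1$ and $i \ge j$; $\alpha(x,y)=2\|y-x\|_\infty + \delta(i,j)$ if $\delta(a,b)=1$ and $i<j$. (This is the maximal height function of domino tilings of the whole plane taking value $0$ at $x$.) A path $(x_1,\dots,x_n)$ of lattice points is geodesic if for each $i<n$ the points $x_i,x_{i+1}$ are corners of a common unit square and $\|x_{i+1}-x_1\|_\infty = \|x_i - x_1\|_\infty + 1$. Write $x \sim_R y$ if there is a geodesic path between $x$ and $y$ lying entirely in $R$.
   Formalization: In the definition of α the cases i ≥ j and i < j are corrected to |i| ≥ |j| and |i| < |j| (the displayed formula makes the claim false already for a single domino), and a geodesic path lies in R when its points and the segments joining consecutive points do. *)

(* Defs.v *)
From HB Require Import structures.
From mathcomp Require Import all_boot all_order all_algebra.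
From mathcomp Require Import all_classical all_reals topology normedtype.

Set Implicit Arguments.
Unset Strict Implicit.
Unset Printing Implicit Defensive.

Import Order.TTheory GRing.Theory Num.Theory.
Import numFieldNormedType.Exports.

Local Open Scope classical_set_scope.
Local Open Scope ring_scope.

Definition lattice_point : Type := (int * int)%type.

(* A unit square is named by its lower-left corner. *)
Definition cell : Type := (int * int)%type.

Definition white (c : cell) : bool := (2 %| c.1 + c.2)%Z.

Definition corners (c : cell) : seq lattice_point :=
  [:: c; (c.1 + 1, c.2); (c.1 + 1, c.2 + 1); (c.1, c.2 + 1)].

(* [left_cell x y c]: (x, y) is a unit grid edge which, traversed from x to y,
   has the square c to its left, i.e. it is one of the four edges met when
   walking counterclockwise around c. *)
Definition left_cell (x y : lattice_point) (c : cell) : bool :=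
  (x, y) \in [:: (c, (c.1 + 1, c.2));
                 ((c.1 + 1, c.2), (c.1 + 1, c.2 + 1));
                 ((c.1 + 1, c.2 + 1), (c.1, c.2 + 1));
                 ((c.1, c.2 + 1), c)].

Section Plane.
Variable K : realType.

Definition embed (p : lattice_point) : K * K := (p.1%:~R, p.2%:~R).

Definition unit_square (c : cell) : set (K * K) :=
  [set z | c.1%:~R <= z.1 <= c.1%:~R + 1 /\ c.2%:~R <= z.2 <= c.2%:~R + 1].

Definition region (S : set cell) : set (K * K) :=
  \bigcup_(c in S) unit_square c.

Definition boundary (A : set (K * K)) : set (K * K) :=
  closure A `\` interior A.

Definition segment (u v : K * K) : set (K * K) :=
  [set ((1 - t) * u.1 + t * v.1, (1 - t) * u.2 + t * v.2) | t in `[0, 1]].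

Definition path_connected (A : set (K * K)) : Prop :=
  forall u v, A u -> A v ->
  exists f : K -> K * K,
    [/\ {within `[0, 1], continuous f}, f 0 = u, f 1 = v
      & forall t, t \in `[0, 1] -> A (f t)].

Definition loops_contractible (A : set (K * K)) : Prop :=
  forall f : K -> K * K,
    {within `[0, 1], continuous f} -> f 0 = f 1 ->
    (forall t, t \in `[0, 1] -> A (f t)) ->
  exists F : K * K -> K * K,
    [/\ {within `[0, 1] `*` `[0, 1], continuous F},
        forall s t, s \in `[0, 1] -> t \in `[0, 1] -> A (F (s, t)),
        forall t, t \in `[0, 1] -> F (0, t) = f t,
        forall t, t \in `[0, 1] -> F (1, t) = f 0
      & forall s, s \in `[0, 1] -> F (s, 0) = f 0 /\ F (s, 1) = f 0].

Definition simply_connected (A : set (K * K)) : Prop :=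
  path_connected A /\ loops_contractible A.

Definition region_points (S : set cell) : set lattice_point :=
  [set p | region S (embed p)].

Definition boundary_points (S : set cell) : set lattice_point :=
  [set p | boundary (region S) (embed p)].

End Plane.

Arguments unit_square K c _ : clear implicits.
Arguments region K S _ : clear implicits.

Definition domino (d : set cell) : Prop :=
  exists c : cell,
    d = [set c; (c.1 + 1, c.2)] \/ d = [set c; (c.1, c.2 + 1)].

Definition tiling (S : set cell) (T : set (set cell)) : Prop :=
  (forall d, T d -> domino d /\ d `<=` S) /\
  (forall c, S c -> exists! d, T d /\ d c).

(* An edge lies on the boundary of a domino when exactly one of the two unit
   squares on its sides is part of the domino. *)
Definition edge_of_tiling (T : set (set cell)) (x y : lattice_point) : Prop :=
  exists2 d, T d & exists c c' : cell,
    [/\ left_cell x y c, left_cell y x c' & d c <-> ~ d c'].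

(* Functions on lattice points are total; only their values on the points of
   the region are constrained. *)
Definition height_function (T : set (set cell)) (h : lattice_point -> int) : Prop :=
  forall x y c,
    edge_of_tiling T x y -> left_cell x y c -> white c -> h x - h y = 1.

Definition height_functions (S : set cell) : set (lattice_point -> int) :=
  [set h | (exists2 T, tiling S T & height_function T h) /\ h 0 = 0].

Definition norm_infty (p : lattice_point) : int := Num.max `|p.1| `|p.2|.

Definition delta (p : lattice_point) : int := ((p.1 - p.2) %% 2)%Z.

(* With (i, j) = y - x, the cases are separated by |i| >= |j|, not by i >= j:
   this is what makes [alpha x] the maximal height function of domino tilings
   of the plane vanishing at x. For instance the edge from (0, 0) to (-1, 0)
   has the white square (-1, -1) to its left, so heights drop by 1 along it, or
   rise by 3 if it cuts a domino: the maximum is 3, whereas the case i < j would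
   give 1. *)
Definition alpha (x y : lattice_point) : int :=
  let d := y - x in
  if delta x == 0 then
    if `|d.1| >= `|d.2| then 2 * norm_infty d + delta d
    else 2 * norm_infty d - delta d
  else
    if `|d.1| >= `|d.2| then 2 * norm_infty d - delta d
    else 2 * norm_infty d + delta d.

Definition geodesic (s : seq lattice_point) : Prop :=
  forall i, (i.+1 < size s)%N ->
    (exists c, s`_i \in corners c /\ s`_i.+1 \in corners c) /\
    norm_infty (s`_i.+1 - s`_0) = norm_infty (s`_i - s`_0) + 1.

(* Not only the points of the path but also the segments joining consecutive
   ones have to be in the region. *)
Definition path_in (K : realType) (S : set cell) (s : seq lattice_point) : Prop :=
  (forall i, (i < size s)%N -> region_points K S s`_i) /\
  (forall i, (i.+1 < size s)%N ->
     segment (embed K s`_i) (embed K s`_i.+1) `<=` region K S).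

Definition geodesic_related (K : realType) (S : set cell)
    (x y : lattice_point) : Prop :=
  exists s : seq lattice_point,
    [/\ (0 < size s)%N, s`_0 = x, s`_(size s).-1 = y, geodesic s
      & path_in K S s].

(* Main.v *)
(* Around a white square the height changes by -1 or +3 along each side walked
   counterclockwise (around a black square, by +1 or -3), and +-3 occurs exactly
   on the side covered by the domino. Summing these bounds along a geodesic
   gives the necessity of the condition.

   For sufficiency, first take the pointwise largest function f1 obeying this
   local law that agrees with h outside the interior, then the smallest one f2
   that still dominates h' on U. At an interior point where it could not be
   moved, such a function is blocked by a neighbor at the extreme height
   difference. Following these tight edges from a point x of U, one travels along
   a geodesic on which the height differs from that at x by exactly alpha: as
   long as only blocked points are met, the tight geodesics from x can be
   prolonged, possibly turning into another of the four directions. Since the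
   region is finite, some such geodesic ends at a boundary point or at a point of
   U where the bound h' is attained, and the hypothesis at its two ends gives
   f1 >= h', respectively f2 <= h', at x. Finally the sides across which f2 jumps
   by 3 cut out the dominoes of a tiling. *)

Require Import Defs.
From mathcomp Require Import all_boot all_order all_algebra.
From mathcomp Require Import all_classical all_reals topology normedtype.
From mathcomp Require Import zify lra ring.

Set Implicit Arguments.
Unset Strict Implicit.
Unset Printing Implicit Defensive.

Import Order.TTheory GRing.Theory Num.Theory.
Import numFieldNormedType.Exports.

Local Open Scope classical_set_scope.
Local Open Scope ring_scope.

(** * The local law of heights and its symmetries *)

(* The flag e keeps track of colors: it is true for a height function in absolute
   coordinates, and flips when the two axes are exchanged or the heights are
   negated, so that the local law below is preserved. *)
Definition ev (e : bool) (i j : int) : bool := e == (2 %| i + j)%Z.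

Definition edge (e : bool) (u v : int) : Prop :=
  if e then v = u - 1 \/ v = u + 3 else v = u + 1 \/ v = u - 3.

Definition square (e : bool) (a b c d : int) : Prop :=
  [/\ edge e a b, edge e b c, edge e c d & edge e d a].

Definition cell_law (e : bool) (g : int -> int -> int) (i j : int) : Prop :=
  square (ev e i j) (g i j) (g (i + 1) j) (g (i + 1) (j + 1)) (g i (j + 1)).

Definition star_law (e : bool) (g : int -> int -> int) (i j : int) : Prop :=
  [/\ cell_law e g i j, cell_law e g (i - 1) j, cell_law e g i (j - 1)
    & cell_law e g (i - 1) (j - 1)].

(** Under the local law, a point that is not blocked lies below its four neighbors, so raising it by
    4 exchanges the two allowed differences on each of its edges. *)
Definition blocked (e : bool) (g : int -> int -> int) (i j : int) : Prop :=
  let s : int := if ev e i j then 1 else 3 in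
  let t : int := if ev e i j then 3 else 1 in
  [\/ g i j - g (i + 1) j = s, g i j - g (i - 1) j = s,
      g i j - g i (j + 1) = t | g i j - g i (j - 1) = t].

Definition mir (T : Type) (g : int -> int -> T) : int -> int -> T :=
  fun i j => g i (- j).

Definition swp (T : Type) (g : int -> int -> T) : int -> int -> T :=
  fun i j => g j i.

Lemma evDr e i j : ev e (i + 1) j = ~~ ev e i j.
Proof. by rewrite /ev; lia. Qed.

Lemma evBr e i j : ev e (i - 1) j = ~~ ev e i j.
Proof. by rewrite /ev; lia. Qed.

Lemma evDl e i j : ev e i (j + 1) = ~~ ev e i j.
Proof. by rewrite /ev; lia. Qed.

Lemma evBl e i j : ev e i (j - 1) = ~~ ev e i j.
Proof. by rewrite /ev; lia. Qed.

Lemma evN e i j : ev e i (- j) = ev e i j.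
Proof. by rewrite /ev; lia. Qed.

Lemma ev_swap e i j : ev (~~ e) i j = ~~ ev e j i.
Proof. by rewrite /ev; lia. Qed.

Definition evE := (evDr, evBr, evDl, evBl, negbK).

Lemma edgeN e u v : edge (~~ e) u v <-> edge e v u.
Proof. by rewrite /edge; case: e => /=; split; lia. Qed.

Lemma square_mir e a b c d : square (~~ e) d c b a <-> square e a b c d.
Proof. by split=> -[] /edgeN ? /edgeN ? /edgeN ? /edgeN ?; split. Qed.

Lemma square_swp e a b c d : square (~~ e) a d c b <-> square e a b c d.
Proof. by split=> -[] /edgeN ? /edgeN ? /edgeN ? /edgeN ?; split. Qed.

(** A reflection reverses the rotation around squares but also exchanges their colors, since the
    square [(i, j)] comes from [(i, - j - 1)]; the two effects cancel and [e] is kept. *)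
Lemma cell_law_mir e g i j : cell_law e g i (- j - 1) -> cell_law e (mir g) i j.
Proof.
rewrite /cell_law /mir evBl evN => H.
by apply/square_mir; rewrite opprD; rewrite subrK in H.
Qed.

(** Exchanging the axes reverses the rotation and preserves colors, so here the flag flips. *)
Lemma cell_law_swp e g i j : cell_law e g j i -> cell_law (~~ e) (swp g) i j.
Proof. by rewrite /cell_law /swp ev_swap => H; apply/square_swp. Qed.

Lemma star_law_mir e g i j : star_law e g i (- j) -> star_law e (mir g) i j.
Proof.
by case=> *; split; apply: cell_law_mir => //; rewrite opprB addrAC subrr add0r.
Qed.

Lemma star_law_swp e g i j : star_law e g j i -> star_law (~~ e) (swp g) i j.
Proof. by case=> *; split; apply: cell_law_swp. Qed.

Lemma blocked_mir e g i j : blocked e g i (- j) -> blocked e (mir g) i j.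
Proof.
rewrite /blocked evN /mir opprD opprB [1 - j]addrC => -[] H.
- exact: Or41. - exact: Or42. - exact: Or44. - exact: Or43.
Qed.

Lemma blocked_swp e g i j : blocked e g j i -> blocked (~~ e) (swp g) i j.
Proof.
rewrite /blocked ev_swap /swp !if_neg => -[] H.
- exact: Or43. - exact: Or44. - exact: Or41. - exact: Or42.
Qed.

(** The twelve edges of the four squares around the point, all oriented away from it, reduce later
    local arguments to integer arithmetic. *)
Lemma star_edges e g i j : star_law e g i j ->
  let b := ev e i j in
  [/\ edge b (g i j) (g (i + 1) j), edge b (g i j) (g (i - 1) j),
      edge (~~ b) (g i j) (g i (j + 1)) & edge (~~ b) (g i j) (g i (j - 1))] /\
  [/\ edge b (g (i + 1) j) (g (i + 1) (j + 1)),
      edge b (g (i + 1) j) (g (i + 1) (j - 1)),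
      edge b (g (i - 1) j) (g (i - 1) (j + 1)) &
      edge b (g (i - 1) j) (g (i - 1) (j - 1))] /\
  [/\ edge (~~ b) (g i (j + 1)) (g (i + 1) (j + 1)),
      edge (~~ b) (g i (j - 1)) (g (i + 1) (j - 1)),
      edge (~~ b) (g i (j + 1)) (g (i - 1) (j + 1)) &
      edge (~~ b) (g i (j - 1)) (g (i - 1) (j - 1))].
Proof.
rewrite /star_law /cell_law /square !evE !subrK; move: (ev e i j) => b.
case=> -[? ? ? ?] [? ? ? ?] [? ? ? ?] [? ? ? ?] /=.
by do !split; first [assumption | exact/(proj1 (edgeN _ _ _))
                   | exact/(proj2 (edgeN _ _ _))].
Qed.

(** * Tight geodesics in one direction *)

(* Points joined to the origin by a geodesic in the direction of the first axis
   along which every step has the extreme height difference; all the points but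
   the last one are in X. *)
Inductive reach (e : bool) (g : int -> int -> int) (X : int -> int -> Prop) :
    int -> int -> Prop :=
| reach0 : reach e g X 0 0
| reach_straight i j : reach e g X i j -> X i j ->
    g i j - g (i + 1) j = (if ev e (i + 1) j then 3 else 1) ->
    reach e g X (i + 1) j
| reach_up i j : reach e g X i j -> X i j ->
    g i j - g (i + 1) (j + 1) = 2 -> reach e g X (i + 1) (j + 1)
| reach_down i j : reach e g X i j -> X i j ->
    g i j - g (i + 1) (j - 1) = 2 -> reach e g X (i + 1) (j - 1).

Lemma reach_mir e g X i j : reach e g X i j -> reach e (mir g) (mir X) i (- j).
Proof.
elim=> {i j} [|i j _ IH Xij H|i j _ IH Xij H|i j _ IH Xij H].
- by rewrite oppr0; exact: reach0.
- by apply: reach_straight => //; rewrite /mir ?evN opprK.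
- by rewrite opprD; apply: reach_down; rewrite /mir ?opprD ?opprK.
- rewrite opprB [1 - j]addrC.
  by apply: reach_up => //; rewrite /mir ?opprD opprK.
Qed.

Lemma mirK T (g : int -> int -> T) : mir (mir g) = g.
Proof. by apply/funext => i; apply/funext => j; rewrite /mir opprK. Qed.

Lemma reach_mirP e g X i j : reach e (mir g) (mir X) i j <-> reach e g X i (- j).
Proof.
split=> /reach_mir; first by rewrite !mirK.
by rewrite opprK.
Qed.

(** Tight geodesics going down: the quarter turn taking [(i, j)] to [(- j, i)] sends their direction
    to the first axis. *)
Definition reach_below e g X i j :=
  reach (~~ e) (swp (mir g)) (swp (mir X)) (- j) i.

Lemma below_straight e g (X : int -> int -> Prop) i j :
  reach_below e g X i j -> X i j ->
  g i j - g i (j - 1) = (if ev e i (j - 1) then 1 else 3) ->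
  reach_below e g X i (j - 1).
Proof.
rewrite /reach_below opprB [1 - j]addrC => r x H; apply: reach_straight => //.
  by rewrite /swp /mir opprK.
by rewrite /swp /mir ev_swap if_neg opprD opprK -evN opprD opprK.
Qed.

Lemma below_diag e g (X : int -> int -> Prop) i j :
  reach_below e g X i j -> X i j -> g i j - g (i + 1) (j - 1) = 2 ->
  reach_below e g X (i + 1) (j - 1).
Proof.
rewrite /reach_below opprB [1 - j]addrC => r x H; apply: reach_up => //.
  by rewrite /swp /mir opprK.
by rewrite /swp /mir opprD opprK.
Qed.

Lemma below0 e g X : reach_below e g X 0 0.
Proof. by rewrite /reach_below oppr0; exact: reach0. Qed.

(** * Tight edges behind or beside the end of a geodesic *)

Definition law_on e g (X : int -> int -> Prop) :=
  forall i j, X i j -> star_law e g i j.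

Lemma law_on_mir e g X : law_on e g X -> law_on e (mir g) (mir X).
Proof. by move=> H i j /H; exact: star_law_mir. Qed.

(* The exceptional configuration in which a tight edge comes from the side of the
   origin: the geodesic is then a diagonal, and can be turned downwards. *)
Definition corner e g (X : int -> int -> Prop) (i j : int) : Prop :=
  [/\ g (i - 1) (j + 1) = g i j + 2, reach_below e g X i j,
      reach_below e g X (i - 1) (j + 1), X (i - 1) (j + 1) & j = - i].

(** The height at [(i, j - 1)] is 3 below that at [(i, j)], which keeps [(i - 1, j - 1)] low and
    forces the left edge at [(i, j)] to be tight too. A tight edge from behind thus propagates back
    along a diagonal. *)
Lemma tight_right_diag e g i j : star_law e g i j -> ev e i j ->
  g i j - g (i + 1) (j - 1) = 2 -> g i (j - 1) = g (i + 1) (j - 1) - 1 ->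
  g (i - 1) j = g i j - 1 /\ g (i - 1) (j - 1) != g i j + 2.
Proof.
move=> /star_edges /= + ev1; rewrite ev1 /=.
by move=> [[_ A _ _] [[_ _ _ B] [_ _ _ C]]]; lia.
Qed.

Lemma corner_step e g X i j : law_on e g X -> X i j -> ev e i j ->
  g i j - g (i + 1) (j - 1) = 2 -> g i (j - 1) = g (i + 1) (j - 1) - 1 ->
  [\/ i = 0 /\ j = 0, corner e g X i j | g (i - 1) (j - 1) = g i j + 2] ->
  corner e g X (i + 1) (j - 1).
Proof.
move=> XL x ev1 H1 H2 H3; rewrite /corner addrK subrK.
have [_ /eqP N] := tight_right_diag (XL _ _ x) ev1 H1 H2.
have [dn ji] : reach_below e g X i j /\ j = - i.
  case: H3 => [[-> ->]|[]|//]; last by [].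
  by split; [exact: below0 | rewrite oppr0].
by split=> //; [lia | exact: below_diag | lia].
Qed.

(** A straight step into an even point drops by 3 and excludes a lower left neighbor. After a
    diagonal step the previous point has one as well, so by induction the geodesic is a diagonal
    issuing from the origin. *)
Lemma even_tight_right e g X : law_on e g X -> forall i j, reach e g X i j ->
  ev e i j -> g (i - 1) j = g i j - 1 ->
  [\/ i = 0 /\ j = 0, corner e g X i j | corner e (mir g) (mir X) i (- j)].
Proof.
move=> XL i j; elim=> {i j} [|i j _ IH x H|i j _ IH x H|i j _ IH x H].
- by move=> _ _; exact: Or31.
- by rewrite addrK => ev1 H1; move: H; rewrite ev1; lia.
- rewrite addrK !evE => ev1 H1; apply: Or33; rewrite opprD.
  have x' : mir X i (- j) by rewrite /mir opprK.
  have ev' : ev e i (- j) by rewrite evN.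
  have H' : mir g i (- j) - mir g (i + 1) (- j - 1) = 2.
    by rewrite /mir opprD !opprK.
  have H1' : mir g i (- j - 1) = mir g (i + 1) (- j - 1) - 1.
    by rewrite /mir opprD !opprK.
  have [T _] := tight_right_diag (law_on_mir XL x') ev' H' H1'.
  apply: corner_step => //; first exact: law_on_mir.
  move: T; rewrite /mir opprK => /(IH ev1)[[-> ->]|[E _ _ _ _]|].
  + by apply: Or31; rewrite oppr0.
  + by apply: Or33; rewrite opprD !opprK.
  + exact: Or32.
- rewrite addrK !evE => ev1 H1; apply: Or32.
  have [T _] := tight_right_diag (XL _ _ x) ev1 H H1.
  apply: corner_step => //; case: (IH ev1 T); [exact: Or31|exact: Or32|].
  by case=> + _ _ _ _; rewrite /mir opprD !opprK => ?; apply: Or33.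
Qed.

(** After a straight or rising step, another last step ends one unit lower. After a descending step,
    the edge below the previous point is tight too; if this goes on back to the origin, the geodesic
    is the descending diagonal, which is also a downward geodesic. *)
Lemma odd_tight_below e g X : law_on e g X ->
  (forall i j, reach e g X i j -> X i j) ->
  forall i j, reach e g X i j -> ~~ ev e i j -> g i (j - 1) = g i j - 1 ->
  reach e g X i (j - 1) \/ reach_below e g X i j /\ j = - i.
Proof.
move=> XL good i j; elim=> {i j} [|i j r IH x H|i j r IH x H|i j r IH x H].
- by move=> _ _; right; split; [exact: below0 | rewrite oppr0].
- move: H => + /negbTE od H1; rewrite od => H; left.
  by apply: reach_down => //; lia.
- rewrite addrK !evE => od H1; left.
  by apply: reach_straight => //; rewrite evE od; lia.
- rewrite !evE => od H1.
  have T : g i (j - 1) = g i j - 1.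
    have /= := star_edges (XL _ _ x); rewrite (negbTE od) /=.
    by move=> [[_ _ _ A] [_ [_ B _ _]]]; lia.
  case: (IH od T) => [r'|[dn ji]].
    by left; apply: reach_down => //; [exact: good | lia].
  by right; split; [exact: below_diag | lia].
Qed.

(** * Prolonging tight geodesics by one step *)

(** The situation to be refuted in a bounded [X]: tight geodesics going forward, down or up never
    leave it. *)
Definition all_good e g (X : int -> int -> Prop) : Prop :=
  [/\ forall i j, X i j -> star_law e g i j /\ blocked e g i j,
      forall i j, reach e g X i j -> X i j,
      forall i j, reach (~~ e) (swp (mir g)) (swp (mir X)) i j ->
        swp (mir X) i j
    & forall i j, reach (~~ e) (swp g) (swp X) i j -> swp X i j].

Definition extends e g (X : int -> int -> Prop) (i : int) : Prop :=
  [\/ exists j, reach e g X (i + 1) j,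
      exists j, reach (~~ e) (swp (mir g)) (swp (mir X)) (i + 1) j
    | exists j, reach (~~ e) (swp g) (swp X) (i + 1) j].

Lemma all_good_mir e g X : all_good e g X -> all_good e (mir g) (mir X).
Proof.
case=> XL good dn up; split.
- by move=> i j /XL[? ?]; split; [exact: star_law_mir | exact: blocked_mir].
- by move=> i j /reach_mirP/good.
- by rewrite !mirK.
- by [].
Qed.

Lemma extends_mir e g X i : extends e (mir g) (mir X) i -> extends e g X i.
Proof.
rewrite /extends !mirK => -[[j /reach_mirP r]|E|E].
- by apply: Or31; exists (- j).
- exact: Or33.
- exact: Or32.
Qed.

(** The diagonal is left one step early for a vertical descent through [(i - 1, j)] to
    [(i - 1, j - 1)], whose depth is [i + 1] because [j = - i]. *)
Lemma corner_extends e g X i j : all_good e g X -> X i j -> ev e i j ->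
  g (i - 1) j = g i j - 1 -> corner e g X i j -> extends e g X i.
Proof.
move=> [XL _ dn _] x ev1 H [H1 b b' x' ji].
have below_good k l : reach_below e g X k l -> X k l.
  by move=> /dn; rewrite /swp /mir opprK.
have b1 : reach_below e g X (i - 1) j.
  have := below_straight b' x'; rewrite addrK !evE ev1 /=.
  by apply; lia.
have x1 := below_good _ _ b1.
have /= E := star_edges (XL _ _ x1).1.
have /= E' := star_edges (XL _ _ x').1.
have b2 : reach_below e g X (i - 1) (j - 1).
  apply: below_straight => //; rewrite !evE ev1 /=.
  (* The known heights exclude three of the four ways in which [(i - 1, j)] can be blocked; only the
     edge below remains. *)
  have [_ ] := XL _ _ x1; rewrite /blocked !evE subrK ev1 /=.
  move: E E'; rewrite !evE !addrK ?subrK ev1 /=.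
  move=> [[_ A _ _] [[_ _ B _] [_ _ C _]]] _.
  by case=> ?; [lia|lia|lia|assumption].
by apply: Or32; exists (i - 1); move: b2; rewrite /reach_below ji opprB addrC opprK.
Qed.

Lemma even_extends e g X i j : all_good e g X -> reach e g X i j -> i != 0 ->
  ev e i j -> extends e g X i.
Proof.
move=> G r i0 ev1; have [XB good _ _] := G; have x := good _ _ r.
have XL : law_on e g X by move=> k l /XB[].
have /= := star_edges (XL _ _ x); rewrite ev1 /=.
move=> [[L _ T D] [[LT LD _ _] [TL DL _ _]]].
case: (eqVneq (g (i + 1) j) (g i j - 1)) => [H|/eqP H].
  apply: Or31; exists j; apply: reach_straight => //.
  by rewrite evE ev1 /=; lia.
(* With the right neighbor 3 higher, a tight vertical edge would break the law in a square on the
   right, so the point is blocked from the left. *)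
have R : g (i - 1) j = g i j - 1.
  by case: (XB _ _ x) => _; rewrite /blocked ev1 => -[]; lia.
case: (even_tight_right XL r ev1 R) => [[? _]|c|c].
- by move/eqP: i0.
- exact: corner_extends c.
- apply: extends_mir; apply: corner_extends c; first exact: all_good_mir.
  + by rewrite /mir opprK.
  + by rewrite evN.
  + by rewrite /mir opprK.
Qed.

(** Either [(i, j - 1)] is reached in the same direction and is even, or the diagonal turns down and
    [(i, j - 1)] has depth [i + 1]. *)
Lemma odd_below_extends e g X i j : all_good e g X -> reach e g X i j ->
  i != 0 -> ~~ ev e i j -> g i (j - 1) = g i j - 1 -> extends e g X i.
Proof.
move=> G r i0 od H; have [XB good _ _] := G; have x := good _ _ r.
have XL : law_on e g X by move=> k l /XB[].
case: (odd_tight_below XL good r od H) => [r'|[dn ji]].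
  by apply: (even_extends G r' i0); rewrite evE.
apply: Or32; exists i.
have : reach_below e g X i (j - 1).
  by apply: below_straight => //; rewrite evE od /= H; lia.
by rewrite /reach_below ji opprB addrC opprK.
Qed.

Lemma odd_not_tight_right e g X i j : law_on e g X ->
  (forall i j, reach e g X i j -> X i j) -> reach e g X i j -> i != 0 ->
  ~~ ev e i j -> g i j - g (i - 1) j <> 3.
Proof.
move=> XL good r; have /= := star_edges (XL _ _ (good _ _ r)).
case: r => {i j} [//|i j r x H|i j r x H|i j r x H] + _ => /[swap] od;
  rewrite (negbTE od) /=.
- by rewrite addrK in H *; move: H; rewrite (negbTE od); lia.
- rewrite !addrK => -[_ [[_ _ _ A] _]]; lia.
- rewrite addrK subrK => -[_ [[_ _ A _] _]]; lia.
Qed.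

Lemma reach_extends e g X i j : all_good e g X -> reach e g X i j -> i != 0 ->
  extends e g X i.
Proof.
move=> G r i0; have [XB good _ _] := G; have x := good _ _ r.
have [ev1|od] := boolP (ev e i j); first exact: even_extends r i0 ev1.
have XL : law_on e g X by move=> k l /XB[].
have N := odd_not_tight_right XL good r i0 od.
case: (XB _ _ x) => _; rewrite /blocked (negbTE od) => -[] H.
- apply: Or31; exists j; apply: reach_straight => //.
  by rewrite evE od.
- by [].
- have {}H : g i (j + 1) = g i j - 1 by lia.
  apply: extends_mir; apply: (odd_below_extends (j := - j)) => //.
  + exact: all_good_mir.
  + exact: reach_mir.
  + by rewrite evN.
  + by rewrite /mir opprD !opprK.
- apply: odd_below_extends r i0 od _ => //; lia.
Qed.

(** * Leaving a bounded set of blocked points *)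

(** The eight symmetries of the lattice fixing the origin. Reflections keep the flag, so it depends
    only on [sw], as [e (+) sw]. *)
Definition frame (sw s t : bool) (T : Type) (g : int -> int -> T) :
    int -> int -> T :=
  fun i j => let i' := if s then - i else i in
             let j' := if t then - j else j in
             if sw then g j' i' else g i' j'.

Lemma mir_frame sw s t T (g : int -> int -> T) :
  mir (frame sw s t g) = frame sw s (~~ t) g.
Proof.
by apply/funext => i; apply/funext => j; rewrite /mir /frame; case: t => //=;
  rewrite opprK.
Qed.

Lemma swp_frame sw s t T (g : int -> int -> T) :
  swp (frame sw s t g) = frame (~~ sw) t s g.
Proof. by apply/funext => i; apply/funext => j; case: sw. Qed.

Lemma law_blocked_frame e g (X : int -> int -> Prop) sw s t :
  (forall i j, X i j -> star_law e g i j /\ blocked e g i j) ->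
  forall i j, frame sw s t X i j ->
    star_law (e (+) sw) (frame sw s t g) i j /\
    blocked (e (+) sw) (frame sw s t g) i j.
Proof.
have m sw' s' t' e' :
    (forall i j, frame sw' s' t' X i j ->
      star_law e' (frame sw' s' t' g) i j /\
      blocked e' (frame sw' s' t' g) i j) ->
    forall i j, frame sw' s' (~~ t') X i j ->
      star_law e' (frame sw' s' (~~ t') g) i j /\
      blocked e' (frame sw' s' (~~ t') g) i j.
  move=> H i j; rewrite -!mir_frame => /H[? ?].
  by split; [exact: star_law_mir | exact: blocked_mir].
have w sw' s' t' e' :
    (forall i j, frame sw' s' t' X i j ->
      star_law e' (frame sw' s' t' g) i j /\
      blocked e' (frame sw' s' t' g) i j) ->
    forall i j, frame (~~ sw') t' s' X i j ->
      star_law (~~ e') (frame (~~ sw') t' s' g) i j /\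
      blocked (~~ e') (frame (~~ sw') t' s' g) i j.
  move=> H i j; rewrite -!swp_frame => /H[? ?].
  by split; [exact: star_law_swp | exact: blocked_swp].
move=> H.
have H00 t' : forall i j, frame false false t' X i j ->
    star_law e (frame false false t' g) i j /\
    blocked e (frame false false t' g) i j.
  by case: t'; [exact: (m false false false) | exact: H].
have H1 s' t' : forall i j, frame true s' t' X i j ->
    star_law (~~ e) (frame true s' t' g) i j /\
    blocked (~~ e) (frame true s' t' g) i j.
  have Hf : forall i j, frame true s' false X i j ->
      star_law (~~ e) (frame true s' false g) i j /\
      blocked (~~ e) (frame true s' false g) i j.
    by apply: (w false false s'); exact: H00.
  by case: t'; [exact: (m true s' false) | exact: Hf].
case: sw => /=; first by rewrite addbT; exact: H1.
by rewrite addbF -[e]negbK; apply: (w true t s); exact: H1.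
Qed.

(** Otherwise tight geodesics could be prolonged forever, whereas [X] is bounded. *)
Lemma reach_exit e g (X : int -> int -> Prop) (N : nat) :
  (forall i j, X i j -> star_law e g i j /\ blocked e g i j) ->
  (forall i j, X i j -> `|i| <= N%:Z /\ `|j| <= N%:Z) ->
  exists sw s i j,
    reach (e (+) sw) (frame sw s false g) (frame sw s false X) i j /\
    ~ frame sw s false X i j.
Proof.
move=> H B; apply: contrapT => /forallNP nex.
have good sw s t i j :
    reach (e (+) sw) (frame sw s t g) (frame sw s t X) i j -> frame sw s t X i j.
  have nf sw' s' i' j' :
      reach (e (+) sw') (frame sw' s' false g) (frame sw' s' false X) i' j' ->
      frame sw' s' false X i' j'.
    move=> r; apply: contrapT => nx; apply: (nex sw').
    by exists s', i', j'; split.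
  case: t; last exact: nf.
  rewrite -(mir_frame sw s false g) -(mir_frame sw s false X).
  by move/reach_mirP/nf.
have G sw s t : all_good (e (+) sw) (frame sw s t g) (frame sw s t X).
  split.
  - exact: law_blocked_frame.
  - exact: good.
  - by move=> i j; rewrite !mir_frame !swp_frame -addbN; exact: good.
  - by move=> i j; rewrite !swp_frame -addbN; exact: good.
(* Prolongation requires a nonzero length, so the first step is made separately, in whichever
   direction the origin is blocked. *)
have first_step sw s : frame sw s false g 0 0 - frame sw s false g (0 + 1) 0 =
    (if ev (e (+) sw) 0 0 then 1 else 3) ->
    reach (e (+) sw) (frame sw s false g) (frame sw s false X) (0 + 1) 0.
  move=> T; apply: reach_straight; first exact: reach0.
    by apply: good; exact: reach0.
  by rewrite T evE if_neg.
(* The frame is quantified anew for each length because a prolongation may turn. *)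
have far (n : nat) : exists sw s t j,
    reach (e (+) sw) (frame sw s t g) (frame sw s t X) (n%:Z + 1) j.
  elim: n => [|n [sw [s [t [j r]]]]].
    have x0 : X 0 0 by apply: (good false false false); exact: reach0.
    have evs : ev (e (+) true) 0 0 = ~~ ev e 0 0 by rewrite addbT ev_swap.
    case: (H _ _ x0) => _; rewrite /blocked => -[] T.
    - exists false, false, false, 0; apply: first_step.
      by rewrite addbF.
    - exists false, true, false, 0; apply: first_step.
      by rewrite addbF /frame oppr0 opprD oppr0.
    - exists true, false, false, 0; apply: first_step.
      by rewrite evs if_neg.
    - exists true, true, false, 0; apply: first_step.
      by rewrite evs if_neg /frame oppr0 opprD oppr0.
  have n0 : n%:Z + 1 != 0 by lia.
  have -> : n.+1%:Z = n%:Z + 1 by lia.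
  case: (reach_extends (G sw s t) r n0) => -[j'].
  - by move=> r'; exists sw, s, t, j'.
  - rewrite !mir_frame !swp_frame -addbN => r'.
    by exists (~~ sw), (~~ t), s, j'.
  - rewrite !swp_frame -addbN => r'.
    by exists (~~ sw), t, s, j'.
have [sw [s [t [j /good]]]] := far N.
by rewrite /frame; case: sw; case: s; case: t => /B; lia.
Qed.

(** Diagonal steps drop by 2 and straight ones alternately by 1 and 3, depending on parity; [e] is
    the parity flag of the origin. The right side is [alpha] in these coordinates. *)
Lemma reach_height e g X i j : reach e g X i j ->
  [/\ `|j| <= i &
      g 0 0 - g i j = 2 * i + (if e then -1 else 1) * ((i - j) %% 2)%Z].
Proof.
elim=> {i j} [|i j _ [IH1 IH2] _|i j _ [IH1 IH2] _ H|i j _ [IH1 IH2] _ H].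
- by case: e; split; lia.
- rewrite /ev; case: e IH2 => IH2.
  + by case: ifP => E H; split; lia.
  + by case: ifP => E H; split; lia.
- by split; [lia | case: e IH2; lia].
- by split; [lia | case: e IH2; lia].
Qed.

Lemma reach_path e g X i j : reach e g X i j ->
  exists2 q : nat -> int, q 0%N = 0 /\ q (absz i) = j &
    forall k, (k < absz i)%N -> X k (q k) /\ `|q k.+1 - q k| <= 1.
Proof.
have step i0 j0 j1 : reach e g X i0 j0 -> X i0 j0 -> `|j1 - j0| <= 1 ->
    (exists2 q : nat -> int, q 0%N = 0 /\ q (absz i0) = j0 &
      forall k, (k < absz i0)%N -> X k (q k) /\ `|q k.+1 - q k| <= 1) ->
    exists2 q : nat -> int, q 0%N = 0 /\ q (absz (i0 + 1)%R) = j1 &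
      forall k, (k < absz (i0 + 1)%R)%N -> X k (q k) /\ `|q k.+1 - q k| <= 1.
  move=> /reach_height[i0j0 _] x J [q [q0 qn] qS].
  have i00 : 0 <= i0 by lia.
  have nE : absz (i0 + 1)%R = (absz i0).+1 by lia.
  exists (fun k => if (k <= absz i0)%N then q k else j1).
    by rewrite nE ltnn q0.
  move=> k; rewrite nE ltnS leq_eqVlt => /predU1P[->|kn].
    by rewrite eqxx ltnn qn; split=> //; rewrite gez0_abs.
  by rewrite kn orbT; exact: qS.
elim=> {i j} [|i j r IH x _|i j r IH x _|i j r IH x _].
- by exists (fun=> 0).
- by apply: step IH => //; rewrite subrr.
- by apply: step IH => //; lia.
- by apply: step IH => //; lia.
Qed.

(** * Maximal functions obeying the local law *)

Definition region_law (e : bool) (S : set cell) (f : int -> int -> int) : Prop :=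
  forall a b, S (a, b) -> cell_law e f a b.

(** The combinatorial counterpart of interior points, matched below with the topological
    boundary. *)
Definition inner (S : set cell) (a b : int) : Prop :=
  [/\ S (a, b), S (a - 1, b), S (a, b - 1) & S (a - 1, b - 1)].

Lemma inner_star_law e S f a b :
  region_law e S f -> inner S a b -> star_law e f a b.
Proof. by move=> L [? ? ? ?]; split; apply: L. Qed.

Definition raise (f : int -> int -> int) (a b : int) : int -> int -> int :=
  fun i j => if (i == a) && (j == b) then f i j + 4 else f i j.

Lemma raise_at f a b : raise f a b a b = f a b + 4.
Proof. by rewrite /raise !eqxx. Qed.

Lemma raise_neq f a b i j : i != a \/ j != b -> raise f a b i j = f i j.
Proof. by rewrite /raise => -[/negbTE->|/negbTE->] //; rewrite andbF. Qed.

Lemma not_blocked_edges e f a b : star_law e f a b -> ~ blocked e f a b ->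
  let s : int := if ev e a b then 3 else 1 in
  let t : int := if ev e a b then 1 else 3 in
  [/\ f (a + 1) b = f a b + s, f (a - 1) b = f a b + s,
      f a (b + 1) = f a b + t & f a (b - 1) = f a b + t].
Proof.
move=> /star_edges /= [[A B C D] _]; move: A B C D; rewrite /blocked /edge.
case: (ev e a b) => /= ? ? ? ? nb.
all: split; apply: contrapT => ?; apply: nb.
all: first [by apply: Or41; lia | by apply: Or42; lia
           | by apply: Or43; lia | by apply: Or44; lia].
Qed.

Lemma raise_cell_law e f a b c d : star_law e f a b -> ~ blocked e f a b ->
  cell_law e f c d -> cell_law e (raise f a b) c d.
Proof.
move=> st nb L; have /= := not_blocked_edges st nb.
have neS (x : int) : x + 1 != x by lia.
have neP (x : int) : x - 1 != x by lia.
have [ca|ca] := eqVneq c a; last first.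
  have [ca'|ca'] := eqVneq (c + 1) a; last first.
    by move=> _; move: L; rewrite /cell_law !raise_neq //; left.
  have {ca ca'} ca : c = a - 1 by lia.
  have [db|db] := eqVneq d b; last first.
    have [db'|db'] := eqVneq (d + 1) b; last first.
      by move=> _; move: L; rewrite /cell_law !raise_neq //; right.
    have {db db'} db : d = b - 1 by lia.
    move: L; rewrite ca db /cell_law !evE !subrK raise_at.
    rewrite !raise_neq; try by [left; exact: neP | right; exact: neP].
    by rewrite /square /edge; case: (ev e a b) => /= -[? ? ? ?] [? ? ? ?]; split; lia.
  move: L; rewrite ca db /cell_law !evE !subrK raise_at.
  rewrite !raise_neq; try by [left; exact: neP | right; exact: neS].
  by rewrite /square /edge; case: (ev e a b) => /= -[? ? ? ?] [? ? ? ?]; split; lia.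
have [db|db] := eqVneq d b; last first.
  have [db'|db'] := eqVneq (d + 1) b; last first.
    by move=> _; move: L; rewrite /cell_law !raise_neq //; right.
  have {db db'} db : d = b - 1 by lia.
  move: L; rewrite ca db /cell_law !evE !subrK raise_at.
  rewrite !raise_neq; try by [left; exact: neS | right; exact: neP].
  by rewrite /square /edge; case: (ev e a b) => /= -[? ? ? ?] [? ? ? ?]; split; lia.
move: L; rewrite ca db /cell_law raise_at.
rewrite !raise_neq; try by [left; exact: neS | right; exact: neS].
by rewrite /square /edge; case: (ev e a b) => /= -[? ? ? ?] [? ? ? ?]; split; lia.
Qed.

Lemma finite_cells_bounded (S : set cell) : finite_set S ->
  exists N : nat, forall c, S c -> `|c.1| <= N%:Z /\ `|c.2| <= N%:Z.
Proof.
move=> /finite_seqP[s ->].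
exists (\max_(c <- s) maxn (absz c.1) (absz c.2))%N => c /= cs.
have := @leq_bigmax_seq _ s xpredT (fun c : cell => maxn (absz c.1) (absz c.2))
  c cs isT.
by rewrite /=; lia.
Qed.

Section Maximal.
Variables (e : bool) (S : set cell) (h cap : int -> int -> int).
Variable U : set lattice_point.
Hypotheses (S_fin : finite_set S) (h_law : region_law e S h).
Hypothesis h_cap : forall a b, U (a, b) ->
  h a b <= cap a b /\ (4 %| cap a b - h a b)%Z.

(* With e = false and negated heights, the same maximality argument yields the
   smallest function above a given lower bound. *)
Definition admissible (f : int -> int -> int) : Prop :=
  [/\ region_law e S f, forall a b, ~ inner S a b -> f a b = h a b,
      forall a b, (4 %| f a b - h a b)%Z
    & forall a b, U (a, b) -> f a b <= cap a b].

Lemma admissible_base : admissible h.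
Proof.
by split=> // a b; [rewrite subrr | case/h_cap].
Qed.

(** Walking right until the point is no longer inner, where the value is that of [h], costs at most
    3 per step. *)
Lemma admissible_bounded a b :
  exists B, forall f, admissible f -> f a b <= B.
Proof.
have [N SN] := finite_cells_bounded S_fin.
suff H k : forall a, (N%:Z < a + k%:Z) ->
    exists B, forall f, admissible f -> f a b <= B.
  by apply: (H (absz (N%:Z + 1 - a)%R)); lia.
elim: k => [|k IH] {}a ak.
  exists (h a b) => f [_ -> //].
  by case=> /SN /= []; lia.
have [i|i] := pselect (inner S a b); last by exists (h a b) => f [_ ->].
have [|B HB] := IH (a + 1); first by lia.
exists (B + 3) => f af; have := HB _ af; case: af => /inner_star_law /(_ i).
move=> /star_edges /= [[+ _ _ _] _]; rewrite /edge; case: (ev e a b); lia.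
Qed.

Lemma raise_admissible f a b : admissible f -> inner S a b ->
  ~ (U (a, b) /\ f a b = cap a b) -> ~ blocked e f a b ->
  admissible (raise f a b).
Proof.
move=> [L out mod4 le] i nt nb; split.
- move=> c d /L; apply: raise_cell_law => //; exact: inner_star_law L i.
- move=> c d ni; rewrite raise_neq; first exact: out.
  by apply: contrapT => /not_orP[/negP/negPn/eqP ? /negP/negPn/eqP ?]; subst.
- by move=> c d; rewrite /raise; case: ifP => _ //; have := mod4 c d; lia.
- move=> c d u; rewrite /raise.
  case: ifP => [/andP[/eqP ca /eqP db]|_]; last exact: le.
  (* Values are congruent modulo 4, so a value strictly below the cap is at least 4 below it. *)
  subst; have := le _ _ u; have [_] := h_cap u; have := mod4 a b.
  have : f a b <> cap a b by move=> E; apply: nt.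
  by lia.
Qed.

(** The sum of the values is bounded, and raising a point that is not blocked and not at its cap
    increases it by 4. Summing over [S] suffices, since an inner point is the lower-left corner of a
    square of [S]. *)
Lemma exists_maximal : exists2 f, admissible f &
  forall a b, inner S a b -> ~ (U (a, b) /\ f a b = cap a b) -> blocked e f a b.
Proof.
have [s0 sS] := proj1 (finite_seqP S) S_fin.
pose s := undup s0; pose size f := \sum_(p <- s) (f p.1 p.2 : int).
have [B HB] : exists B : int * int -> int,
    forall p f, admissible f -> f p.1 p.2 <= B p.
  have /choice[B HB] := fun p : int * int => admissible_bounded p.1 p.2.
  by exists B.
have le_size f : admissible f -> size f <= \sum_(p <- s) B p.
  by move=> af; apply: ler_sum => p _; exact: HB.
have raise_size f a b : inner S a b -> size (raise f a b) = size f + 4.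
  case=> + _ _ _; rewrite sS /= -mem_undup => ps.
  rewrite /size (bigD1_seq (a, b)) ?undup_uniq //= raise_at.
  rewrite [in RHS](bigD1_seq (a, b)) ?undup_uniq //= addrAC.
  congr (_ + _ + _); apply: eq_bigr => -[c d] ne.
  rewrite raise_neq //; apply/orP; rewrite -negb_and.
  by move: ne; rewrite xpair_eqE.
suff H (n : nat) : forall f, admissible f -> \sum_(p <- s) B p - size f <= n%:Z ->
    exists2 f, admissible f & forall a b, inner S a b ->
      ~ (U (a, b) /\ f a b = cap a b) -> blocked e f a b.
  apply: (H (absz (\sum_(p <- s) B p - size h)%R) h admissible_base).
  by have := le_size _ admissible_base; lia.
elim: n => [|n IH] f af fn; apply: contrapT => nex.
all: have [a [b [i ar]]] :
    exists a b, inner S a b /\ admissible (raise f a b).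
  1, 3: apply: contrapT => nr; apply: nex; exists f => // a b i nt.
  1, 2: apply: contrapT => nb; apply: nr.
  1, 2: by exists a, b; split=> //; exact: raise_admissible.
all: have le := le_size _ ar; have E := raise_size f _ _ i.
- by lia.
- by apply: nex; apply: (IH _ ar); lia.
Qed.

End Maximal.

(** * Lattice points, squares and segments in the plane *)

Lemma mem_corners (c : cell) (p : lattice_point) :
  (p \in corners c) = [&& c.1 <= p.1, p.1 <= c.1 + 1, c.2 <= p.2 & p.2 <= c.2 + 1].
Proof.
case: c p => [a b] [x y]; rewrite /corners !inE !xpair_eqE /=; lia.
Qed.

Lemma between_int (K : realType) (c a : int) (t : K) : 0 < t < 1 ->
  c%:~R <= a%:~R + t <= c%:~R + 1 -> c = a.
Proof.
move=> /andP[t0 t1] /andP[h1 h2].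
have H1 : (c%:~R : K) < (a + 1)%:~R by rewrite intrD; lra.
have H2 : (a%:~R : K) < (c + 1)%:~R by rewrite intrD; lra.
by move: H1 H2; rewrite !ltr_int; lia.
Qed.

Section Geometry.
Variables (K : realType) (S : set cell).

Lemma corner_in_square (c : cell) (p : lattice_point) :
  p \in corners c -> unit_square K c (embed K p).
Proof.
rewrite mem_corners /unit_square /embed /= => /and4P[h1 h2 h3 h4].
move: h1 h2 h3 h4; rewrite -!(ler_int K) !intrD => -> -> -> ->.
by [].
Qed.

Lemma corner_in_region (c : cell) (p : lattice_point) :
  S c -> p \in corners c -> region_points K S p.
Proof. by move=> Sc pc; exists c => //; exact: corner_in_square. Qed.

Lemma segment_in_square (c : cell) (p q : lattice_point) :
  p \in corners c -> q \in corners c ->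
  segment (embed K p) (embed K q) `<=` unit_square K c.
Proof.
move=> /corner_in_square + /corner_in_square; rewrite /unit_square /=.
move=> [/andP[a1 a2] /andP[b1 b2]] [/andP[a3 a4] /andP[b3 b4]] z [t /= +] <- /=.
rewrite in_itv /= => /andP[t0 t1]; split; apply/andP; split; nra.
Qed.

Lemma inner_not_boundary a b : inner S a b -> ~ boundary_points K S (a, b).
Proof.
move=> [S1 S2 S3 S4] [_]; apply.
rewrite /interior /=; apply/nbhs_ballP; exists 1 => //= -[u v] [/= + +].
rewrite -!ball_normE /= !ltr_norml => /andP[u1 u2] /andP[v1 v2].
have [ua|ua] := leP a%:~R u; have [vb|vb] := leP b%:~R v.
- by exists (a, b) => //; split=> /=; apply/andP; split; lra.
- by exists (a, b - 1) => //; split=> /=; rewrite ?intrB; apply/andP; split; lra.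
- by exists (a - 1, b) => //; split=> /=; rewrite ?intrB; apply/andP; split; lra.
- by exists (a - 1, b - 1) => //; split=> /=; rewrite ?intrB; apply/andP; split; lra.
Qed.

(** A ball inside the region would meet the open interior of each of the four squares around the
    point. A point there lies in no other square, so all four would be in [S]. *)
Lemma region_point_boundary a b : region_points K S (a, b) -> ~ inner S a b ->
  boundary_points K S (a, b).
Proof.
move=> rp ni; split; first exact: subset_closure.
rewrite /interior /= => /nbhs_ballP[r /= r0 ball_S].
(* Less than the radius and at most one half, so that both [t] and [1 - t] are offsets strictly
   inside a unit interval. *)
pose t : K := Num.min (r / 2) (1 / 2).
have [t0 t1 tr] : [/\ 0 < t, t < 1 & t < r].
  by rewrite /t; case: (leP (r / 2) (1 / 2)); split; lra.
apply: ni.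
have cell_near (x y : int) (u v : K) : 0 < u < 1 -> 0 < v < 1 ->
    `|a%:~R - (x%:~R + u)| < r -> `|b%:~R - (y%:~R + v)| < r -> S (x, y).
  move=> u01 v01 ur vr.
  have [|[c d] Scd [/= cu dv]] := ball_S (x%:~R + u, y%:~R + v).
    by split; rewrite /= -ball_normE.
  by rewrite -(between_int u01 cu) -(between_int v01 dv).
have tI : 0 < t < 1 by rewrite t0 t1.
have tI' : 0 < 1 - t < 1 by apply/andP; split; lra.
have pos (x : int) : `|x%:~R - (x%:~R + t)| < r by rewrite ltr_norml; lra.
have neg (x : int) : `|x%:~R - ((x - 1)%:~R + (1 - t))| < r.
  by rewrite intrB ltr_norml; lra.
split; first exact: (cell_near _ _ _ _ tI tI (pos a) (pos b)).
- exact: (cell_near _ _ _ _ tI' tI (neg a) (pos b)).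
- exact: (cell_near _ _ _ _ tI tI' (pos a) (neg b)).
- exact: (cell_near _ _ _ _ tI' tI' (neg a) (neg b)).
Qed.

Lemma inner_step a b p : inner S a b -> `|p.1 - a| <= 1 -> `|p.2 - b| <= 1 ->
  exists2 c, S c & ((a, b) \in corners c) && (p \in corners c).
Proof.
case: p => x y [S1 S2 S3 S4] /= xa yb.
case: (leP a x) => ax; case: (leP b y) => by_.
- by exists (a, b) => //; rewrite !mem_corners /=; lia.
- by exists (a, b - 1) => //; rewrite !mem_corners /=; lia.
- by exists (a - 1, b) => //; rewrite !mem_corners /=; lia.
- by exists (a - 1, b - 1) => //; rewrite !mem_corners /=; lia.
Qed.

Lemma geodesic_related_path (p : nat -> lattice_point) (n : nat) :
  region_points K S (p 0%N) ->
  (forall k, (k < n)%N ->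
    exists2 c, S c & (p k \in corners c) && (p k.+1 \in corners c)) ->
  (forall k, (k <= n)%N -> norm_infty (p k - p 0%N) = k%:Z) ->
  geodesic_related K S (p 0%N) (p n).
Proof.
move=> r0 step dist; exists (mkseq p n.+1).
have nthp k : (k <= n)%N -> (mkseq p n.+1)`_k = p k by move=> kn; rewrite nth_mkseq.
rewrite size_mkseq; split=> //=.
- exact: (nthp _ (leqnn n)).
- move=> k; rewrite size_mkseq ltnS => kn.
  rewrite !nthp //; last exact: ltnW.
  rewrite !dist //; last exact: ltnW.
  split; last by lia.
  by have [c _ /andP[]] := step _ kn; exists c.
- split=> k; rewrite size_mkseq ltnS => kn.
    rewrite nthp //; case: k kn => [//|k] kn.
    by have [c Sc /andP[_]] := step _ kn; exact: corner_in_region.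
  rewrite !nthp //; last exact: ltnW.
  have [c Sc /andP[pc qc] z zs] := step _ kn.
  by exists c => //; exact: (segment_in_square pc qc).
Qed.

(** Midpoints serve as test points: that of a unit edge lies only in the two adjacent squares, that
    of a diagonal only in its own square. *)
Lemma segment_midpoint (u v : K * K) :
  segment u v ((u.1 + v.1) / 2, (u.2 + v.2) / 2).
Proof.
exists (1 / 2); first by rewrite /= in_itv /=; lra.
by congr (_, _); lra.
Qed.

Lemma vertical_edge_cell a b :
  segment (embed K (a, b)) (embed K (a, b + 1)) `<=` region K S ->
  S (a, b) \/ S (a - 1, b).
Proof.
move=> /(_ _ (segment_midpoint _ _)) [[c d] Sc [/= /andP[h1 h2] h3]].
have -> : b = d.
  apply/esym/(@between_int K _ _ (1 / 2)); first by lra.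
  by move: h3; rewrite intrD => /andP[? ?]; apply/andP; split; lra.
have : c <= a /\ a <= c + 1.
  by split; rewrite -(ler_int K) ?intrD; lra.
move=> ca; have [E|E] : a = c \/ a - 1 = c by lia.
  by left; rewrite E.
by right; rewrite E.
Qed.

Lemma horizontal_edge_cell a b :
  segment (embed K (a, b)) (embed K (a + 1, b)) `<=` region K S ->
  S (a, b) \/ S (a, b - 1).
Proof.
move=> /(_ _ (segment_midpoint _ _)) [[c d] Sc [/= h3 /andP[h1 h2]]].
have -> : a = c.
  apply/esym/(@between_int K _ _ (1 / 2)); first by lra.
  by move: h3; rewrite intrD => /andP[? ?]; apply/andP; split; lra.
have : d <= b /\ b <= d + 1.
  by split; rewrite -(ler_int K) ?intrD; lra.
move=> ca; have [E|E] : b = d \/ b - 1 = d by lia.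
  by left; rewrite E.
by right; rewrite E.
Qed.

Lemma diagonal_cell (p q : lattice_point) (c : cell) :
  p \in corners c -> q \in corners c ->
  p.1 != q.1 -> p.2 != q.2 -> segment (embed K p) (embed K q) `<=` region K S -> S c.
Proof.
case: p q c => [x y] [z w] [a b]; rewrite !mem_corners /=.
move=> /and4P[? ? ? ?] /and4P[? ? ? ?] xz yw.
move=> /(_ _ (segment_midpoint _ _)) [[c d] Sc [/= h1 h2]].
have xE : (x%:~R + z%:~R : K) / 2 = a%:~R + 1 / 2.
  have -> : z = 2 * a + 1 - x by lia.
  by rewrite intrB intrD intrM; lra.
have yE : (y%:~R + w%:~R : K) / 2 = b%:~R + 1 / 2.
  have -> : w = 2 * b + 1 - y by lia.
  by rewrite intrB intrD intrM; lra.
have half : 0 < (1 / 2 : K) < 1 by lra.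
rewrite xE in h1; rewrite yE in h2.
by rewrite -(between_int half h1) -(between_int half h2).
Qed.

End Geometry.

(** * From tilings to the local law *)

Lemma left_cell_sides x y (a b : int) c : left_cell x y (a, b) -> left_cell y x c ->
  [\/ [/\ x = (a, b), y = (a + 1, b) & c = (a, b - 1)],
      [/\ x = (a + 1, b), y = (a + 1, b + 1) & c = (a + 1, b)],
      [/\ x = (a + 1, b + 1), y = (a, b + 1) & c = (a, b + 1)]
    | [/\ x = (a, b + 1), y = (a, b) & c = (a - 1, b)] ].
Proof.
case: x y c => [x1 x2] [y1 y2] [c1 c2]; rewrite /left_cell !inE !xpair_eqE /=.
case/or4P => /andP[/andP[/eqP-> /eqP->] /andP[/eqP-> /eqP->]] H.
- have [-> ->] : c1 = a /\ c2 = b - 1 by lia.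
  exact: Or41.
- have [-> ->] : c1 = a + 1 /\ c2 = b by lia.
  exact: Or42.
- have [-> ->] : c1 = a /\ c2 = b + 1 by lia.
  exact: Or43.
- have [-> ->] : c1 = a - 1 /\ c2 = b by lia.
  exact: Or44.
Qed.

Lemma left_cell_inj x y c c' : left_cell x y c -> left_cell x y c' -> c = c'.
Proof.
case: x y c c' => [x1 x2] [y1 y2] [c1 c2] [d1 d2].
rewrite /left_cell !inE !xpair_eqE /= => H H'.
by congr (_, _); lia.
Qed.

Lemma left_cell_corners x y c : left_cell x y c ->
  (x \in corners c) && (y \in corners c).
Proof.
case: x y c => [x1 x2] [y1 y2] [c1 c2].
by rewrite !mem_corners /left_cell !inE !xpair_eqE /=; lia.
Qed.

Lemma left_cell_white x y c c' : left_cell x y c -> left_cell y x c' ->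
  white c' = ~~ white c.
Proof.
case: c => a b h1 h2; rewrite /white.
by case: (left_cell_sides h1 h2) => -[_ _ ->] /=; lia.
Qed.

Lemma left_cell_bottom (a b : int) : left_cell (a, b) (a + 1, b) (a, b) /\
  left_cell (a + 1, b) (a, b) (a, b - 1).
Proof. by rewrite /left_cell !inE !xpair_eqE /=; lia. Qed.

Lemma left_cell_right (a b : int) : left_cell (a + 1, b) (a + 1, b + 1) (a, b) /\
  left_cell (a + 1, b + 1) (a + 1, b) (a + 1, b).
Proof. by rewrite /left_cell !inE !xpair_eqE /=; lia. Qed.

Lemma left_cell_top (a b : int) : left_cell (a + 1, b + 1) (a, b + 1) (a, b) /\
  left_cell (a, b + 1) (a + 1, b + 1) (a, b + 1).
Proof. by rewrite /left_cell !inE !xpair_eqE /=; lia. Qed.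

Lemma left_cell_left (a b : int) : left_cell (a, b + 1) (a, b) (a, b) /\
  left_cell (a, b) (a, b + 1) (a - 1, b).
Proof. by rewrite /left_cell !inE !xpair_eqE /=; lia. Qed.

Definition uncut (h : lattice_point -> int) (x y : lattice_point) (c : cell) :=
  h y = h x + (if white c then -1 else 1).

Lemma uncutC h x y c c' : left_cell x y c -> left_cell y x c' ->
  uncut h x y c <-> uncut h y x c'.
Proof.
move=> h1 h2; rewrite /uncut (left_cell_white h1 h2).
by case: (white c) => /=; split; lia.
Qed.

Lemma tile_side T h d x y c c' : height_function T h -> T d -> d c -> ~ d c' ->
  left_cell x y c -> left_cell y x c' -> uncut h x y c.
Proof.
move=> H Td dc dc' h1 h2; rewrite /uncut.
have e1 : edge_of_tiling T x y by exists d => //; exists c, c'; split.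
have e2 : edge_of_tiling T y x by exists d => //; exists c', c; split.
case: ifP => w; first by have := H _ _ _ e1 h1 w; lia.
have w' : white c' by rewrite (left_cell_white h1 h2) w.
by have := H _ _ _ e2 h2 w'; lia.
Qed.

Lemma domino_partner d (a b : int) : domino d -> d (a, b) ->
  [\/ d = [set (a, b); (a, b - 1)], d = [set (a, b); (a + 1, b)],
      d = [set (a, b); (a, b + 1)] | d = [set (a, b); (a - 1, b)] ].
Proof.
move=> [[u v] /= [->|->]] [[-> ->]|[-> ->]].
- exact: Or42.
- by apply: Or44; rewrite addrK setUC.
- exact: Or43.
- by apply: Or41; rewrite addrK setUC.
Qed.

Lemma white_ev (a b : int) : white (a, b) = ev true a b.
Proof. by []. Qed.

(** The three sides not covered by the domino have differences of absolute value 1 and equal sign;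
    closing the circuit gives 3 with the opposite sign on the fourth. *)
Lemma tiling_law S T h : tiling S T -> height_function T h ->
  region_law true S (fun a b => h (a, b)).
Proof.
move=> [TS Tex] H a b Sc; have [d [[Td dc] _]] := Tex _ Sc.
have [dom _] := TS _ Td.
have side x y c' : ~ d c' -> left_cell x y (a, b) /\ left_cell y x c' ->
    uncut h x y (a, b).
  by move=> ndc' [? ?]; exact: (tile_side H Td dc ndc').
have bottom := side _ _ _ _ (left_cell_bottom a b).
have right := side _ _ _ _ (left_cell_right a b).
have top := side _ _ _ _ (left_cell_top a b).
have left := side _ _ _ _ (left_cell_left a b).
move: bottom right top left; rewrite /uncut white_ev /cell_law /square /edge.
case: (domino_partner dom dc) => ->.
all: case: (ev true a b) => /= bottom right top left.
all: do ?[have {}bottom := bottom (ltac:(move=> [[]|[]]; lia))].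
all: do ?[have {}right := right (ltac:(move=> [[]|[]]; lia))].
all: do ?[have {}top := top (ltac:(move=> [[]|[]]; lia))].
all: do ?[have {}left := left (ltac:(move=> [[]|[]]; lia))].
all: split; lia.
Qed.

(** * From the local law to a tiling *)

Section TilingOfLaw.
Variables (S : set cell) (f : lattice_point -> int).
Hypothesis f_law : region_law true S (fun a b => f (a, b)).
Hypothesis f_boundary : forall x y c c',
  left_cell x y c -> left_cell y x c' -> S c -> ~ S c' -> uncut f x y c.

Definition cut (c c' : cell) : Prop :=
  exists x y, [/\ left_cell x y c, left_cell y x c' & ~ uncut f x y c].

Definition cut_dominoes : set (set cell) :=
  [set d | exists c c', [/\ S c, S c', cut c c' & d = [set c; c'] ]].

Lemma cutC c c' : cut c c' -> cut c' c.
Proof.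
move=> [x [y [h1 h2 n]]]; exists y, x; split=> //.
by move/(uncutC f h1 h2).
Qed.

Lemma cut_mem c c' : S c -> cut c c' -> S c'.
Proof.
move=> Sc [x [y [h1 h2 n]]]; apply: contrapT => nS.
by apply: n; exact: f_boundary nS.
Qed.

(** Four differences of absolute value 1 with the same sign cannot sum to 0 around a square. *)
Lemma cut_exists c : S c -> exists c', cut c c'.
Proof.
case: c => a b Sc; apply: contrapT => /forallNP nex.
have side x y c' : left_cell x y (a, b) /\ left_cell y x c' -> uncut f x y (a, b).
  by move=> [? ?]; apply: contrapT => ?; apply: (nex c'); exists x, y.
have := f_law Sc; rewrite /cell_law /square.
have := side _ _ _ (left_cell_bottom a b).
have := side _ _ _ (left_cell_right a b).
have := side _ _ _ (left_cell_top a b).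
have := side _ _ _ (left_cell_left a b).
by rewrite /uncut white_ev; case: (ev true a b); lia.
Qed.

(** Two jumps of 3 have the same sign, and the other two sides cannot compensate them. *)
Lemma cut_unique c c1 c2 : S c -> cut c c1 -> cut c c2 -> c1 = c2.
Proof.
case: c => a b /f_law + [x [y [h1 h2 n]]] [x' [y' [h1' h2' n']]].
rewrite /cell_law /square => -[].
move: n n'; rewrite /uncut white_ev.
case: (left_cell_sides h1 h2) => -[-> -> ->];
  case: (left_cell_sides h1' h2') => -[-> -> ->] //.
all: by case: (ev true a b); rewrite /edge /=; lia.
Qed.

Lemma cut_dominoes_tiling : tiling S cut_dominoes.
Proof.
split.
  move=> _ [[a b] [c' [Sc Sc' [x [y [h1 h2 n]]] ->]]]; split; last first.
    by move=> e [->|->].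
  case: (left_cell_sides h1 h2) => -[_ _ ->].
  - by exists (a, b - 1); right; rewrite /= subrK setUC.
  - by exists (a, b); left.
  - by exists (a, b); right.
  - by exists (a - 1, b); left; rewrite /= subrK setUC.
move=> c Sc; have [c' cc'] := cut_exists Sc.
exists [set c; c']; split.
  split; last by left.
  by exists c, c'; split=> //; exact: cut_mem cc'.
move=> _ [[c1 [c2 [Sc1 Sc2 c12 ->]]] [E|E]]; rewrite /= in E; subst.
- by rewrite (cut_unique Sc cc' c12).
- by rewrite (cut_unique Sc cc' (cutC c12)) setUC.
Qed.

Lemma cut_same_domino d c c' : cut_dominoes d -> d c -> cut c c' -> d c'.
Proof.
move=> [c1 [c2 [Sc1 Sc2 c12 ->]]] [->|->] H /=.
- by right; exact: cut_unique H c12.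
- by left; exact: cut_unique H (cutC c12).
Qed.

(** Two squares separated by a cut edge form one domino, so every domino contains both or neither,
    and such an edge does not belong to the tiling. *)
Lemma cut_dominoes_height : height_function cut_dominoes f.
Proof.
move=> x y c [d Td [c1 [c' [h1 h2 dE]]]] h w.
rewrite -(left_cell_inj h h1) in dE.
suff : uncut f x y c by rewrite /uncut w; lia.
apply: contrapT => n; have cc' : cut c c' by exists x, y; split.
have [dc|dc] := pselect (d c); have [H1 H2] := dE.
- by apply: (H1 dc); exact: cut_same_domino cc'.
- have dc' : d c' by apply: contrapT => /H2.
  by apply: dc; exact: cut_same_domino Td dc' (cutC cc').
Qed.

End TilingOfLaw.

(** * Necessity: the height bound along a geodesic *)

Lemma lipschitz_steps (q : nat -> int) (n : nat) :
  (forall k, (k < n)%N -> `|q k.+1 - q k| <= 1) ->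
  forall k m, (k + m <= n)%N -> `|q (k + m)%N - q k| <= m%:Z.
Proof.
move=> step k; elim=> [|m IH] km; first by rewrite addn0 subrr.
have := step (k + m)%N; rewrite -addnS => /(_ km).
by have := IH (ltnW (leq_trans _ km)); rewrite addnS ltnS leqnn => /(_ isT); lia.
Qed.

(** Steps that change parity have bounds alternating between 3 and 1, so their deviations from 2
    cancel in pairs, leaving at most the first. *)
Lemma walk_bound (u : nat -> int) (par : nat -> bool) (n : nat) :
  (forall k, (k < n)%N ->
    (par k.+1 = par k /\ u k.+1 - u k <= 2) \/
    (par k.+1 = ~~ par k /\ u k.+1 - u k <= if par k then 3 else 1)) ->
  u n - u 0%N <= 2 * n%:Z + (if par n == par 0%N then 0 else
                             if par 0%N then 1 else -1).
Proof.
elim: n => [|n IH] step; first by rewrite eqxx subrr.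
have {IH}IH := IH (fun k kn => step k (ltnW kn)).
case: (step n (ltnSn n)) => -[-> H].
  by move: IH; case: (par n == par 0%N); case: (par 0%N); lia.
by move: IH H; case: (par n); case: (par 0%N) => /=; lia.
Qed.

Lemma alpha_horizontal (x y : lattice_point) (n : int) :
  `|(y - x).2| <= `|(y - x).1| -> `|(y - x).1| = n ->
  alpha x y = 2 * n + (if ev true y.1 y.2 == ev true x.1 x.2 then 0 else
                       if ev true x.1 x.2 then 1 else -1).
Proof.
case: x y => [x1 x2] [y1 y2]; rewrite /alpha /norm_infty /= => H <-.
rewrite H (max_idPl H) /delta /ev /=.
by case: ifP => E; case: ifP => E1; try case: ifP => E2; lia.
Qed.

(** Vertical edges have the opposite sign convention, hence the flag [false]. On diagonals [delta]
    vanishes, so the formula agrees there with the horizontal one. *)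
Lemma alpha_vertical (x y : lattice_point) (n : int) :
  `|(y - x).1| <= `|(y - x).2| -> `|(y - x).2| = n ->
  alpha x y = 2 * n + (if ev false y.1 y.2 == ev false x.1 x.2 then 0 else
                       if ev false x.1 x.2 then 1 else -1).
Proof.
case: x y => [x1 x2] [y1 y2]; rewrite /alpha /norm_infty /= => H <-.
rewrite (max_idPr H) /delta /ev /=.
by case: ifP => E; case: ifP => E1; case: ifP => E2; try case: ifP => E3; lia.
Qed.

Section Bound.
Variables (K : realType) (S : set cell) (f : lattice_point -> int).
Hypothesis f_law : region_law true S (fun a b => f (a, b)).

Lemma segmentC (u v : K * K) : segment u v `<=` segment v u.
Proof.
move=> _ [t /= + <-]; rewrite in_itv /= => /andP[t0 t1].
exists (1 - t); first by rewrite /= in_itv /=; apply/andP; split; lra.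
by congr (_, _); ring.
Qed.

Lemma horizontal_edge (a b : int) : S (a, b) \/ S (a, b - 1) ->
  edge (ev true a b) (f (a, b)) (f (a + 1, b)).
Proof.
move=> [] /f_law []; first by [].
by rewrite !evE subrK => _ _ /edgeN.
Qed.

Lemma vertical_edge (a b : int) : S (a, b) \/ S (a - 1, b) ->
  edge (~~ ev true a b) (f (a, b)) (f (a, b + 1)).
Proof.
move=> [] /f_law []; first by move=> _ _ _ ?; apply/edgeN.
by rewrite !evE subrK.
Qed.

Lemma diagonal_step (p q : lattice_point) (c : cell) : S c ->
  p \in corners c -> q \in corners c -> p.1 != q.1 -> p.2 != q.2 ->
  f q - f p <= 2.
Proof.
case: p q c => [x y] [z w] [a b] /f_law; rewrite !mem_corners /=.
move=> law h1 h2 xz yw.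
have : (x = a /\ z = a + 1 \/ x = a + 1 /\ z = a) /\
       (y = b /\ w = b + 1 \/ y = b + 1 /\ w = b) by lia.
move: law; rewrite /cell_law /square /edge => law.
by move=> [[[-> ->]|[-> ->]] [[-> ->]|[-> ->]]]; move: law;
  case: (ev true a b) => /= -[? ? ? ?]; lia.
Qed.

Lemma parity_diagonal e (x y z w : int) : `|z - x| = 1 -> `|w - y| = 1 ->
  ev e z w = ev e x y.
Proof. by rewrite /ev; lia. Qed.

Lemma horizontal_step (p q : lattice_point) (c : cell) :
  p \in corners c -> q \in corners c ->
  segment (embed K p) (embed K q) `<=` region K S -> `|q.1 - p.1| = 1 ->
  (ev true q.1 q.2 = ev true p.1 p.2 /\ f q - f p <= 2) \/
  (ev true q.1 q.2 = ~~ ev true p.1 p.2 /\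
   f q - f p <= if ev true p.1 p.2 then 3 else 1).
Proof.
move=> pc qc seg d1; have [E|ne] := eqVneq p.2 q.2; last first.
  have ne1 : p.1 != q.1 by lia.
  have Sc := diagonal_cell pc qc ne1 ne seg.
  left; split; last exact: (diagonal_step Sc).
  apply: parity_diagonal => //; move: pc qc; rewrite !mem_corners; lia.
right; case: p q E seg d1 {pc qc} => [x y] [z w] /= <- seg d1.
have [zE|xE] : z = x + 1 \/ x = z + 1 by lia.
  subst z; rewrite evDr; split=> //.
  have := horizontal_edge (horizontal_edge_cell seg).
  by rewrite /edge; case: (ev true x y) => /=; lia.
subst x; rewrite evDr negbK; split=> //.
have {}seg := subset_trans (@segmentC _ _) seg.
have := horizontal_edge (horizontal_edge_cell seg).
by rewrite /edge; case: (ev true z y) => /=; lia.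
Qed.

Lemma vertical_step (p q : lattice_point) (c : cell) :
  p \in corners c -> q \in corners c ->
  segment (embed K p) (embed K q) `<=` region K S -> `|q.2 - p.2| = 1 ->
  (ev false q.1 q.2 = ev false p.1 p.2 /\ f q - f p <= 2) \/
  (ev false q.1 q.2 = ~~ ev false p.1 p.2 /\
   f q - f p <= if ev false p.1 p.2 then 3 else 1).
Proof.
have evF (x y : int) : ev false x y = ~~ ev true x y by rewrite /ev; lia.
move=> pc qc seg d2; have [E|ne] := eqVneq p.1 q.1; last first.
  have ne2 : p.2 != q.2 by lia.
  have Sc := diagonal_cell pc qc ne ne2 seg.
  left; split; last exact: (diagonal_step Sc).
  apply: parity_diagonal => //; move: pc qc; rewrite !mem_corners; lia.
right; case: p q E seg d2 {pc qc} => [x y] [z w] /= <- seg d2; rewrite !evF.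
have [wE|yE] : w = y + 1 \/ y = w + 1 by lia.
  subst w; rewrite evDl; split=> //.
  have := vertical_edge (vertical_edge_cell seg).
  by rewrite /edge; case: (ev true x y) => /=; lia.
subst y; rewrite evDl !negbK; split=> //.
have {}seg := subset_trans (@segmentC _ _) seg.
have := vertical_edge (vertical_edge_cell seg).
by rewrite /edge; case: (ev true x w) => /=; lia.
Qed.

Lemma geodesic_height_le x y : geodesic_related K S x y ->
  f y - f x <= alpha x y.
Proof.
move=> [s [s0 xE yE geo [_ seg]]]; set n := (size s).-1 in yE.
have sn k : (k < n)%N -> (k.+1 < size s)%N by rewrite /n; lia.
pose p k : lattice_point := s`_k.
have dist k : (k <= n)%N -> norm_infty (p k - x) = k%:Z.
  rewrite -xE; elim: k => [|k IH] kn; first by rewrite subrr.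
  by have [_ ->] := geo _ (sn _ kn); rewrite IH ?(ltnW kn) //; lia.
have near k : (k < n)%N ->
    `|(p k.+1).1 - (p k).1| <= 1 /\ `|(p k.+1).2 - (p k).2| <= 1.
  move=> /sn/geo[[c [pc qc]] _]; move: pc qc; rewrite !mem_corners /p.
  by set u := s`_k; set v := s`_k.+1; lia.
have lip1 := lipschitz_steps (fun k kn => (near k kn).1).
have lip2 := lipschitz_steps (fun k kn => (near k kn).2).
have dist' k : (k <= n)%N -> Num.max `|(p k).1 - x.1| `|(p k).2 - x.2| = k%:Z.
  exact: dist.
have yE' : y = p n by [].
have xE' : x = p 0%N by [].
have dn := dist' n (leqnn n).
have [d12|d12] := leP `|(y - x).2| `|(y - x).1|.
  (* The first coordinate has to move by [n] in [n] steps of size at most 1, so no step leaves it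
     unchanged or goes back. *)
  have all1 k : (k < n)%N -> `|(p k.+1).1 - (p k).1| = 1.
    move=> kn; have [near1 _] := near k kn.
    have := lip1 k.+1 (n - k.+1)%N; rewrite subnKC // => /(_ (leqnn n)).
    have := dist' k (ltnW kn); have := dist' _ kn.
    by move: d12 dn; rewrite yE' /=; lia.
  have step k : (k < n)%N -> _ :=
    fun kn => let: conj (ex_intro c (conj pc qc)) _ := geo _ (sn _ kn) in
    horizontal_step pc qc (seg _ (sn _ kn)) (all1 _ kn).
  have := @walk_bound (fun k => f (p k)) (fun k => ev true (p k).1 (p k).2) n step.
  rewrite -yE' -xE' -(@alpha_horizontal x y n%:Z) //.
  by move: dn; rewrite -yE'; move: d12 => /=; lia.
have all2 k : (k < n)%N -> `|(p k.+1).2 - (p k).2| = 1.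
  move=> kn; have [_ near2] := near k kn.
  have := lip2 k.+1 (n - k.+1)%N; rewrite subnKC // => /(_ (leqnn n)).
  have := dist' k (ltnW kn); have := dist' _ kn.
  by move: d12 dn; rewrite yE' /=; lia.
have step k : (k < n)%N -> _ :=
  fun kn => let: conj (ex_intro c (conj pc qc)) _ := geo _ (sn _ kn) in
  vertical_step pc qc (seg _ (sn _ kn)) (all2 _ kn).
have := @walk_bound (fun k => f (p k)) (fun k => ev false (p k).1 (p k).2) n step.
rewrite -yE' -xE' -(@alpha_vertical x y n%:Z) //; first exact: ltW.
by move: dn; rewrite -yE'; move: d12 => /=; lia.
Qed.

End Bound.

(** * Sufficiency: where an extremal function is attained *)

Lemma ev_ev e (a b i j : int) : ev (ev e a b) i j = ev e (a + i) (b + j).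
Proof. by rewrite /ev; lia. Qed.

Definition shift (a b : int) (f : int -> int -> int) : int -> int -> int :=
  fun i j => f (a + i) (b + j).

Lemma star_law_shift e f (a b i j : int) : star_law e f (a + i) (b + j) ->
  star_law (ev e a b) (shift a b f) i j.
Proof.
by rewrite /star_law /cell_law !ev_ev /shift !addrA.
Qed.

Lemma blocked_shift e f (a b i j : int) : blocked e f (a + i) (b + j) ->
  blocked (ev e a b) (shift a b f) i j.
Proof. by rewrite /blocked ev_ev /shift !addrA. Qed.

(** Absolute position of the point that [frame sw s false], applied after [shift a b], sees at
    [(i, j)]. *)
Definition frame_point (sw s : bool) (a b i j : int) : lattice_point :=
  let i' := if s then - i else i in
  if sw then (a + j, b + i') else (a + i', b + j).

Lemma norm_frame_point sw s (a b i j k l : int) : `|j - l| <= i - k ->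
  norm_infty (frame_point sw s a b i j - frame_point sw s a b k l) = i - k /\
  norm_infty (frame_point sw s a b k l - frame_point sw s a b i j) = i - k.
Proof. by case: sw; case: s; rewrite /frame_point /norm_infty /=; split; lia. Qed.

(** For [e = false] the heights are negated, so a drop becomes a rise and the arguments of [alpha]
    change places. *)
Lemma alpha_frame_point e sw s (a b i j : int) : `|j| <= i ->
  let y := frame_point sw s a b i j in
  2 * i + (if ev e a b (+) sw then -1 else 1) * ((i - j) %% 2)%Z =
  if e then alpha y (a, b) else alpha (a, b) y.
Proof.
move=> ji /=; case: sw; case: s; rewrite /frame_point /=.
all: case: e.
1-4: rewrite (@alpha_vertical _ _ i) /=; [|by lia|by lia].
5-8: rewrite (@alpha_horizontal _ _ i) /=; [|by lia|by lia].
all: rewrite /ev.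
all: by case: (boolP (2 %| a + b)%Z) => E /=; case: ifP => E1 /=;
  try (case: ifP => E2 /=); lia.
Qed.

Section Extremal.
Variables (K : realType) (e : bool) (S : set cell) (h cap : int -> int -> int).
Variable U : set lattice_point.
Hypotheses (S_fin : finite_set S) (h_law : region_law e S h).
Hypothesis h_cap : forall a b, U (a, b) ->
  h a b <= cap a b /\ (4 %| cap a b - h a b)%Z.

Lemma exists_extremal : exists2 f, admissible e S h cap U f &
  forall a b, region_points K S (a, b) -> exists c d,
    [/\ region_points K S (c, d), ~ inner S c d \/ U (c, d) /\ f c d = cap c d,
        geodesic_related K S (a, b) (c, d), geodesic_related K S (c, d) (a, b)
      & f a b - f c d =
        if e then alpha (c, d) (a, b) else alpha (a, b) (c, d)].
Proof.
have [f af blk] := exists_maximal S_fin h_law h_cap.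
exists f => // a b rab; have [L _ _ _] := af.
(* The free points, in coordinates centered at [(a, b)]: maximality blocks each of them. A tight
   geodesic leaving them ends where the value is prescribed or the cap attained; it has length 0 if
   [(a, b)] is not free. *)
pose X (i j : int) := inner S (a + i) (b + j) /\
  ~ (U (a + i, b + j) /\ f (a + i) (b + j) = cap (a + i) (b + j)).
have [N SN] := finite_cells_bounded S_fin.
have [| |sw [s [i [j [r nX]]]]] :=
    @reach_exit (ev e a b) (shift a b f) X (N + absz a + absz b)%N.
- move=> i j [ij nt]; split.
    by apply: star_law_shift; exact: inner_star_law L ij.
  by apply: blocked_shift; exact: blk.
- by move=> i j [[/SN /= [? ?] _ _ _] _]; lia.
pose P i j := frame_point sw s a b i j.
have frX k l : frame sw s false X k l ->
    inner S (P k l).1 (P k l).2.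
  by rewrite /P /frame_point /frame /X; case: (sw) => -[].
have [ji hE] := reach_height r; have [q [q0 qn] qS] := reach_path r.
set n := absz i in qn qS; have iE : i = n%:Z by rewrite /n; lia.
have lip := lipschitz_steps (fun k kn => (qS k kn).2).
pose p k := P k%:Z (q k).
have dist k l : (k <= l <= n)%N ->
    norm_infty (p l - p k) = l%:Z - k%:Z /\ norm_infty (p k - p l) = l%:Z - k%:Z.
  move=> /andP[kl ln]; apply: norm_frame_point.
  by have := lip k (l - k)%N; rewrite subnKC // => /(_ ln); lia.
have step k : (k < n)%N ->
    exists2 c, S c & (p k \in corners c) && (p k.+1 \in corners c).
  move=> kn; have [/frX + q1] := qS k kn; rewrite -/(p k).
  case E : (p k) => [u v] /= uv; apply: inner_step uv _ _.
    move: E; rewrite /p /P /frame_point; case: (sw); case: (s) => -[<- _] /=; lia.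
  move: E; rewrite /p /P /frame_point; case: (sw); case: (s) => -[_ <-] /=; lia.
case E : (P i j) => [c d].
have pn : p n = (c, d) by rewrite /p qn -iE.
have p0 : p 0%N = (a, b).
  rewrite /p q0 /P /frame_point.
  by case: (sw); case: (s); rewrite ?oppr0 !addr0.
have rel : geodesic_related K S (a, b) (c, d).
  rewrite -p0 -pn; apply: geodesic_related_path; rewrite ?p0 //.
  by move=> k kn; rewrite -p0; have [-> _] := dist 0%N k kn; rewrite subr0.
have rcd : region_points K S (c, d).
  have [s' [s'0 _ <- _ [+ _]]] := rel.
  by move/(_ (size s').-1); apply; rewrite prednK.
exists c, d; split=> //.
- apply: contrapT => /not_orP[/contrapT ni nt]; apply: nX.
  move: E ni nt; rewrite /P /frame_point /frame /X.
  by case: (sw); case: (s) => -[<- <-].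
(* Distances along the path are known between any two indices, so the reversed path is geodesic as
   well. *)
- have -> : (c, d) = p (n - 0)%N by rewrite subn0.
  have -> : (a, b) = p (n - n)%N by rewrite subnn.
  apply: (@geodesic_related_path K S (fun k => p (n - k)%N) n).
  + by rewrite subn0 pn.
  + move=> k kn; have [|c' Sc'] := step (n - k.+1)%N; first by lia.
    by rewrite -subSn // subSS andbC; exists c'.
  + move=> k kn; have [|_ ->] := dist (n - k)%N (n - 0)%N; lia.
have fE : shift a b f 0 0 - f c d =
    2 * i + (if ev e a b (+) sw then -1 else 1) * ((i - j) %% 2)%Z.
  rewrite -hE; congr (_ - _); first by rewrite /frame oppr0; case: (sw); case: (s).
  move: E; rewrite /P /frame_point /frame /shift.
  by case: (sw); case: (s) => -[<- <-].
rewrite /shift !addr0 in fE; rewrite fE.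
by have /= -> := @alpha_frame_point e sw s a b i j ji; rewrite -/(P i j) E.
Qed.

End Extremal.

(** * Combining the two extremal functions *)

Lemma corner_not_inner (S : set cell) (c : cell) (x : lattice_point) :
  ~ S c -> x \in corners c -> ~ inner S x.1 x.2.
Proof.
case: c x => [a b] [u v] nS; rewrite mem_corners /= => H [h1 h2 h3 h4].
have [E|[E|[E|E]]] : (u = a /\ v = b) \/ (u - 1 = a /\ v = b) \/
    (u = a /\ v - 1 = b) \/ (u - 1 = a /\ v - 1 = b) by lia.
all: by case: E nS => <- <-.
Qed.

Lemma tiling_exterior S T h x y c c' : tiling S T -> height_function T h ->
  left_cell x y c -> left_cell y x c' -> S c -> ~ S c' -> uncut h x y c.
Proof.
move=> [TS Tex] H h1 h2 Sc nS; have [d [[Td dc] _]] := Tex _ Sc.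
apply: (tile_side H Td dc _ h1 h2) => dc'.
by apply: nS; exact: (TS _ Td).2.
Qed.

Lemma cell_law_opp e f a b :
  cell_law e f a b -> cell_law (~~ e) (fun i j => - f i j) a b.
Proof.
have -> : cell_law (~~ e) (fun i j => - f i j) a b = square (~~ ev e a b)
    (- f a b) (- f (a + 1) b) (- f (a + 1) (b + 1)) (- f a (b + 1)).
  by rewrite /cell_law /ev; congr square; lia.
rewrite /cell_law /square /edge.
by case: (ev e a b) => /= -[? ? ? ?]; split; lia.
Qed.

Theorem theorem2p3 (K : realType) (S : set cell) (U : set lattice_point)
  (h h' : lattice_point -> int)
  (S_finite : finite_set S)
  (S_simply_connected : simply_connected (region K S))
  (origin_boundary : boundary_points K S 0)
  (h_H : height_functions S h)
  (U_region : U `<=` region_points K S)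
  (boundary_U : boundary_points K S `<=` U)
  (h'_boundary : forall x, boundary_points K S x -> h' x = h x)
  (h'_mod4 : forall x, U x -> (h' x = h x %[mod 4])%Z) :
  (exists2 h_ext : lattice_point -> int,
     height_functions S h_ext & forall x, U x -> h_ext x = h' x) <->
  (forall x y, U x -> U y -> geodesic_related K S x y ->
     h' y - h' x <= alpha x y).
Proof.
split=> [[f [[T TS Tf] _] fE] x y Ux Uy xy|H].
  rewrite -!fE //; apply: geodesic_height_le xy; exact: tiling_law TS Tf.
case: h_H => [[T TS Th] h0].
pose hc a b := h (a, b).
have h_law : region_law true S hc by exact: tiling_law TS Th.
have outer a b : region_points K S (a, b) -> ~ inner S a b ->
    U (a, b) /\ h (a, b) = h' (a, b).
  move=> r ni; have bp := region_point_boundary r ni.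
  by split; [exact: boundary_U | rewrite h'_boundary].
(* With an empty set of caps, tight geodesics of [f1] can end only at points that are not inner. *)
have [f1 [f1_law f1_out f1_mod _] f1_ext] :=
  @exists_extremal K true S hc hc set0 S_finite h_law (fun _ _ => False_ind _).
have f1_ge a b : U (a, b) -> h' (a, b) <= f1 a b.
  move=> Uab; have rab := U_region _ Uab.
  have [c [d [rcd [ni|[]//] _ rel E]]] := f1_ext _ _ rab.
  (* Here [f1 a b] equals [h' (c, d) + alpha (c, d) (a, b)], which the hypothesis bounds below by
     [h' (a, b)]. *)
  have [Ucd hh'] := outer _ _ rcd ni; have := H _ _ Ucd Uab rel.
  by move: E; rewrite (f1_out _ _ ni) /hc hh'; lia.
have f1N_law : region_law false S (fun a b => - f1 a b).
  by move=> a b /f1_law; exact: cell_law_opp.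
have mod4 x : U x -> (4 %| h' x - h x)%Z.
  by move=> Ux; rewrite -eqz_mod_dvd; apply/eqP; exact: h'_mod4.
(* After negation the lower bound [h'] becomes a cap, and [f1_ge] says that [- f1] respects it. *)
have [|f2 [f2_law f2_out _ f2_le] f2_ext] :=
  @exists_extremal K false S (fun a b => - f1 a b) (fun a b => - h' (a, b)) U
    S_finite f1N_law.
  move=> a b Uab; have := f1_ge _ _ Uab; have := mod4 _ Uab.
  by have := f1_mod a b; rewrite /hc; lia.
pose f (x : lattice_point) := - f2 x.1 x.2.
have f_out x : ~ inner S x.1 x.2 -> f x = h x.
  by case: x => a b ni; rewrite /f f2_out //= opprK f1_out.
have f_U x : U x -> f x = h' x.
  case: x => a b Uab; rewrite /f /=; have rab := U_region _ Uab.
  have [c [d [rcd ter rel _ E]]] := f2_ext _ _ rab.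
  have [Ucd f2E] : U (c, d) /\ f2 c d = - h' (c, d).
    case: ter => // ni; have [Ucd hh'] := outer _ _ rcd ni; split=> //.
    by rewrite f2_out // f1_out // /hc hh'.
  (* Now [f (a, b) = h' (c, d) - alpha (a, b) (c, d)] is at most [h' (a, b)]; the cap gives the
     opposite inequality. *)
  have := H _ _ Uab Ucd rel; have := f2_le _ _ Uab.
  by move: E; rewrite f2E; lia.
have f_law : region_law true S (fun a b => f (a, b)).
  by move=> a b /f2_law /cell_law_opp.
have f_boundary x y c c' : left_cell x y c -> left_cell y x c' -> S c -> ~ S c' ->
    uncut f x y c.
  (* Both ends of an edge of an exterior square fail to be inner, so [f] coincides there with [h],
     whose tiling has no domino across this edge. *)
  move=> h1 h2 Sc nS; have /andP[yc xc] := left_cell_corners h2.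
  rewrite /uncut !f_out; try exact: corner_not_inner nS _.
  exact: tiling_exterior TS Th h1 h2 Sc nS.
exists f => //; split.
  exists (cut_dominoes S f); first exact: cut_dominoes_tiling.
  exact: cut_dominoes_height.
rewrite f_out //; move=> i0; exact: (inner_not_boundary (K := K)) i0 origin_boundary.
Qed.
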